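(* Assume the standing assumptions of the context ($X$, $U$ compact; $\ell$, $g$ and $L_fv$ for all $v\in C^1([t_0,T]\times X)$ continuous; trial-induced measures of uniformly bounded total mass). Suppose (i) (nested capacity) $\Theta^{(M)}\subseteq\Theta^{(M+1)}$ for all $M\ge1$; (ii) (trial density) for each fixed $m\ge1$, every $(\mu,\mu_T)\in\mathcal F_m$ is the weak-$\star$ limit of $(\mu_{\theta_M},\mu_{T,\theta_M})$ as $M\to\infty$ for some sequence $\theta_M\in\Theta^{(M)}$ with $\|r_{\theta_M}^{(m)}\|_{\ast,m}\to0$. Then $$\lim_{\eta\downarrow0}\ \lim_{M\to\infty}P^{\mathrm{exp}}_{m,M}(\eta)=P_m\qquad\text{for every fixed }m\ge1.$$ If additionally (iii) (test density) $\bigcup_{m\ge1}\mathcal V_m$ is dense in $C^1([t_0,T]\times X)$ for the $C^1$ norm, and $P_m\to P$ as $m\to\infty$, then $$\lim_{m\to\infty}\ \lim_{\eta\downarrow0}\ \lim_{M\to\infty}P^{\mathrm{exp}}_{m,M}(\eta)=P.$$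
   Context: Setting. Let $t_0<T$, $X\subset\mathbb R^n$ and $U\subset\mathbb R^{d}$ compact, $Z:=[t_0,T]\times X\times U$, dynamics $f:Z\to\mathbb R^n$, running cost $\ell:Z\to\mathbb R$, terminal cost $g:X\to\mathbb R$. $\mathcal V:=C^1([t_0,T]\times X)$ and, for $v\in\mathcal V$, $(L_fv)(t,x,u):=\partial_tv(t,x)+\nabla_xv(t,x)^\top f(t,x,u)$. It is assumed that $\ell$, $g$, and $L_fv$ (for all $v\in\mathcal V$) are continuous. $\mathcal M_+(\cdot)$ denotes finite nonnegative Borel measures, $\langle\phi,\rho\rangle:=\int\phi\,d\rho$, $\mathcal M:=\mathcal M_+(Z)\times\mathcal M_+(\{T\}\times X)$, and $\mu_0\in\mathcal M_+(\{t_0\}\times X)$ is fixed. Weak-$\star$ convergence of measures is against continuous functions. Exact occupation-measure linear program: $P:=\inf\{\langle\ell,\mu\rangle+\langle g,\mu_T\rangle:(\mu,\mu_T)\in\mathcal M,\ \langle v,\mu_T-\mu_0\rangle=\langle L_fv,\mu\rangle\ \forall v\in\mathcal V\}$. Test families: $\mathcal V_m=\mathrm{span}\{v_1,\dots,v_m\}\subset\mathcal V$, and $\|\cdot\|_{\ast,m}$ is a norm on $\mathbb R^m$. Truncated problem: $\mathcal F_m:=\{(\mu,\mu_T)\in\mathcal M:\langle v,\mu_T-\mu_0\rangle=\langle L_fv,\mu\rangle\ \forall v\in\mathcal V_m\}$ and $P_m:=\inf_{(\mu,\mu_T)\in\mathcal F_m}\langle\ell,\mu\rangle+\langle g,\mu_T\rangle$.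 Trial families: for each $M\ge1$, $\Theta^{(M)}$ is a set of finite-dimensional parameters, each $\theta$ inducing a pair $(\mu_\theta,\mu_{T,\theta})\in\mathcal M$ (the induced pair of a given $\theta$ does not depend on $M$); the total masses of $\mu_\theta,\mu_{T,\theta}$ are bounded uniformly over all $\theta\in\bigcup_M\Theta^{(M)}$. Cost $J(\theta):=\langle\ell,\mu_\theta\rangle+\langle g,\mu_{T,\theta}\rangle$; residual vector $$r_\theta^{(m)}:=\big(\langle v_j,\mu_{T,\theta}-\mu_0\rangle-\langle L_fv_j,\mu_\theta\rangle\big)_{j=1}^m\in\mathbb R^m.$$ Restricted value, for $\eta>0$: $P^{\mathrm{exp}}_{m,M}(\eta):=\inf\{J(\theta):\theta\in\Theta^{(M)},\ \|r_\theta^{(m)}\|_{\ast,m}\le\eta\}$. Infima over empty sets are $+\infty$. *)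

(* Defs.v *)
From HB Require Import structures.
From mathcomp Require Export all_boot all_order all_algebra.
From mathcomp Require Export all_classical all_reals all_analysis.
Export numFieldNormedType.Exports.

Set Implicit Arguments.
Unset Strict Implicit.
Unset Printing Implicit Defensive.

Export Order.TTheory GRing.Theory Num.Theory.

#[global] Open Scope classical_set_scope.
#[global] Open Scope ring_scope.

(* Join of the pointed and topological structures, which products lack. *)
HB.instance Definition _ (S S' : ptopologicalType) := Pointed.on (S * S')%type.

Definition borel (S : ptopologicalType) := g_sigma_algebraType (@open S).

(* Finite Borel measures on the ambient space. A measure on a Borel subset D,
   i.e. an element of M_+(D), is an ambient one that is null off D. *)
Definition fmeasure (R : realType) (S : ptopologicalType) :=
  {finite_measure set (borel S) -> \bar R}.

Definition carried_by (R : realType) (S : ptopologicalType)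
    (D : set S) (rho : fmeasure R S) : Prop :=
  rho (~` D) = 0%E.

(* Functions on D are total functions of which only the values on D matter;
   hence integrals are restricted to D. *)
Definition pairing (R : realType) (S : ptopologicalType)
    (D : set S) (phi : S -> R) (rho : fmeasure R S) : R :=
  (\int[rho]_(z in (D : set (borel S))) phi z)%R.

Definition weak_star_cvg (R : realType) (S : ptopologicalType)
    (D : set S) (rho_ : nat -> fmeasure R S) (rho : fmeasure R S) : Prop :=
  forall phi : S -> R, {within D, continuous phi} ->
    pairing D phi (rho_ k) @[k --> \oo] --> pairing D phi rho.

Definition is_norm (R : realType) (m : nat) (N : 'rV[R]_m -> R) : Prop :=
  [/\ forall x y, N (x + y) <= N x + N y,
      forall a x, N (a *: x) = `|a| * N x &
      forall x, N x = 0 -> x = 0].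

Record ocp (R : realType) (n d : nat) := Ocp {
  t_ini : R;
  t_fin : R;
  state_set : set 'rV[R]_n;
  control_set : set 'rV[R]_d;
  dynamics : R * 'rV[R]_n * 'rV[R]_d -> 'rV[R]_n;
  running_cost : R * 'rV[R]_n * 'rV[R]_d -> R;
  terminal_cost : 'rV[R]_n -> R }.

Section Ocp.
Variables (R : realType) (n d : nat) (pb : ocp R n d).
Implicit Types (mu : fmeasure R (R * 'rV[R]_n)%type)
  (vs : nat -> R * 'rV[R]_n -> R).

Definition tx_set : set (R * 'rV[R]_n) :=
  [set` `[t_ini pb, t_fin pb]] `*` state_set pb.

Definition txu_set : set (R * 'rV[R]_n * 'rV[R]_d) :=
  tx_set `*` control_set pb.

Definition init_set : set (R * 'rV[R]_n) := [set t_ini pb] `*` state_set pb.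

Definition term_set : set (R * 'rV[R]_n) := [set t_fin pb] `*` state_set pb.

Definition dt (v : R * 'rV[R]_n -> R) (p : R * 'rV[R]_n) : R :=
  'D_((1, 0) : R * 'rV[R]_n) v p.

Definition grad_x (v : R * 'rV[R]_n -> R) (p : R * 'rV[R]_n) : 'rV[R]_n :=
  \row_i 'D_((0, delta_mx 0 i) : R * 'rV[R]_n) v p.

(* C^1([t0,T] x X): continuously differentiable on some open neighbourhood of
   the compact set [t0,T] x X, so that the derivatives make sense at every one
   of its points, whatever the shape of X. *)
Definition C1 : set (R * 'rV[R]_n -> R) :=
  [set v | exists O : set (R * 'rV[R]_n),
    [/\ open O, tx_set `<=` O &
        forall p, O p ->
          [/\ differentiable v p, {for p, continuous (dt v)} &
              {for p, continuous (grad_x v)}]]].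

Definition C1_norm (v : R * 'rV[R]_n -> R) : R :=
  sup [set `|v p| | p in tx_set] + sup [set `|dt v p| | p in tx_set]
  + sup [set `|grad_x v p| | p in tx_set].

Definition Lf (v : R * 'rV[R]_n -> R) (z : R * 'rV[R]_n * 'rV[R]_d) : R :=
  dt v z.1 + \sum_(i < n) grad_x v z.1 0 i * dynamics pb z 0 i.

Definition mpair : Type :=
  (fmeasure R (R * 'rV[R]_n * 'rV[R]_d)%type
   * fmeasure R (R * 'rV[R]_n)%type)%type.

Definition admissible : set mpair :=
  [set q | carried_by txu_set q.1 /\ carried_by term_set q.2].

Definition cost (q : mpair) : R :=
  pairing txu_set (running_cost pb) q.1
  + pairing term_set (fun p => terminal_cost pb p.2) q.2.

Definition defect (mu0 : fmeasure R (R * 'rV[R]_n)%type) (q : mpair)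
    (v : R * 'rV[R]_n -> R) : R :=
  pairing term_set v q.2 - pairing init_set v mu0
  - pairing txu_set (Lf v) q.1.

Definition feasible mu0 (W : set (R * 'rV[R]_n -> R)) : set mpair :=
  [set q | admissible q /\ forall v, W v ->
     pairing term_set v q.2 - pairing init_set v mu0
     = pairing txu_set (Lf v) q.1].

Definition lp_value mu0 (W : set (R * 'rV[R]_n -> R)) : \bar R :=
  ereal_inf [set (cost q)%:E | q in feasible mu0 W].

(* [vs j] stands for v_(j+1). *)
Definition test_span (vs : nat -> R * 'rV[R]_n -> R) (m : nat) :
    set (R * 'rV[R]_n -> R) :=
  [set v | exists c : 'rV[R]_m,
     v = (fun p => \sum_(j < m) c 0 j * vs j p)].

Definition P_exact mu0 : \bar R := lp_value mu0 C1.

Definition P_trunc mu0 vs (m : nat) : \bar R := lp_value mu0 (test_span vs m).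

Definition test_dense (vs : nat -> R * 'rV[R]_n -> R) : Prop :=
  forall v, C1 v -> forall e : R, 0 < e ->
    exists m w, [/\ (1 <= m)%N, test_span vs m w &
                    C1_norm (fun p => v p - w p) < e].

(* Finite-dimensional parameter vectors; the dimension may grow with the
   capacity. *)
Definition param : Type := {k : nat & 'rV[R]_k}.

Definition residual mu0 vs (m : nat) (q : mpair) : 'rV[R]_m :=
  \row_(j < m) defect mu0 q (vs j).

Definition P_exp mu0 vs (N : forall m, 'rV[R]_m -> R)
    (Theta : nat -> set param) (occ : param -> mpair)
    (m M : nat) (eta : R) : \bar R :=
  ereal_inf [set (cost (occ theta))%:E | theta in
    Theta M `&` [set theta | N m (residual mu0 vs m (occ theta)) <= eta]].

Definition trial_dense mu0 vs (N : forall m, 'rV[R]_m -> R)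
    (Theta : nat -> set param) (occ : param -> mpair) (m : nat) : Prop :=
  forall q, feasible mu0 (test_span vs m) q ->
    exists theta : nat -> param,
      [/\ forall M, (1 <= M)%N -> Theta M (theta M),
          weak_star_cvg txu_set (fun M => (occ (theta M)).1) q.1,
          weak_star_cvg term_set (fun M => (occ (theta M)).2) q.2 &
          N m (residual mu0 vs m (occ (theta M))) @[M --> \oo] --> (0 : R)].

End Ocp.

(* Main.v *)
(* Only finitely many functionals of a pair (mu, mu_T) enter the cost and the
   m-th residual, so weak-star compactness of measures is replaced by a
   finite-dimensional statement: for a compact K and continuous phi : K -> R^p,
   the vectors of integrals of phi against measures carried by K of mass at most
   B form a compact set.  Indeed they are exactly the sums of p terms c_i phi(z_i)
   with c_i >= 0, sum c_i <= B and z_i in K.  These sums form a compact set, which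
   is convex by Caratheodory's theorem, and a vector of integrals that was not
   among them would be separated from them at its nearest point, contradicting
   the monotonicity of the integral.
   Trial pairs with residual at most 1/(k+1) and cost at most a thus have moment
   vectors that accumulate at those of a pair in F_m of cost at most a, which
   bounds P_m by the iterated limit; the other inequality is trial density, and
   both limits exist by monotonicity. *)
Require Import Defs.
From HB Require Import structures.
From mathcomp Require Import measurable_realfun ring lra.

Set Implicit Arguments.
Unset Strict Implicit.
Unset Printing Implicit Defensive.

(** * Borel measurability and integrability on compact sets *)

Lemma borel_open (S : ptopologicalType) (O : set S) :
  open O -> measurable (O : set (borel S)).
Proof. by move=> oO; apply: sub_sigma_algebra. Qed.

Lemma borel_closed (S : ptopologicalType) (K : set S) :
  closed K -> measurable (K : set (borel S)).
Proof.
move=> cK; rewrite -[K]setCK; apply: measurableC; apply: borel_open.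
exact: closed_openC.
Qed.

Lemma borel_compact (S : ptopologicalType) (K : set S) :
  hausdorff_space S -> compact K -> measurable (K : set (borel S)).
Proof. by move=> hS cK; apply: borel_closed; exact: compact_closed. Qed.

(** Preimages of open intervals are traces on [K] of open sets of [S]. *)
Lemma borel_within_continuous (R : realType) (S : ptopologicalType)
    (K : set S) (phi : S -> R) :
  measurable (K : set (borel S)) -> {within K, continuous phi} ->
  measurable_fun (K : set (borel S)) phi.
Proof.
move=> mK /continuousP cphi.
apply: (measurability (RGenOpens.G (R := R))).
  exact: RGenOpens.measurableE.
move=> _ [_ [a [b ->]] <-].
have oab : open `]a, b[%classic by exact: interval_open.
have /open_subspaceP[V oV VK] := cphi _ oab.
by rewrite setIC -VK; apply: measurableI => //; exact: borel_open.
Qed.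

Lemma compact_continuous_bounded (R : realType) (S : topologicalType)
    (K : set S) (phi : S -> R) :
  compact K -> {within K, continuous phi} ->
  exists C, forall z, K z -> `|phi z| <= C.
Proof.
move=> cK cphi.
have [C [_ CP]] := @compact_bounded R R _ (continuous_compact cphi cK).
(* [CP] bounds the values by every constant strictly above [C], hence the shift by 1. *)
by exists (C + 1) => z Kz; apply: (CP (C + 1)); [rewrite ltrDl|exists z].
Qed.

Lemma compact_integrable (R : realType) (S : ptopologicalType)
    (rho : fmeasure R S) (K : set S) (phi : S -> R) :
  hausdorff_space S -> compact K -> {within K, continuous phi} ->
  rho.-integrable (K : set (borel S)) (EFin \o phi).
Proof.
move=> hS cK cphi; have mK := borel_compact hS cK.
apply: measurable_bounded_integrable => //.
- by rewrite ltey_eq fin_num_measure.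
- exact: borel_within_continuous.
have [C phiC] := compact_continuous_bounded cK cphi.
exists C; split; first exact: num_real.
by move=> x Cx z /phiC/le_trans; apply; exact: ltW.
Qed.

Lemma within_continuousZ (R : realType) (S : topologicalType) (K : set S)
    (a : R) (phi : S -> R) :
  {within K, continuous phi} -> {within K, continuous (fun z => a * phi z)}.
Proof. by move=> cphi z; apply: cvgM; [exact: cvg_cst|exact: cphi]. Qed.

Lemma within_continuous_sum (R : realType) (S : topologicalType) (K : set S)
    (p : nat) (phi : 'I_p -> S -> R) :
  (forall i, {within K, continuous (phi i)}) ->
  {within K, continuous (fun z => \sum_i phi i z)}.
Proof.
move=> cphi z; apply: cvg_big => [|i _]; first exact: add_continuous.
exact: cphi.
Qed.

(** * Finite measures and their pairings with continuous functions *)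

Section FMeasureAdd.
Variables (R : realType) (S : ptopologicalType) (rho1 rho2 : fmeasure R S).

Definition fmeasure_add : set (borel S) -> \bar R := measure_add rho1 rho2.

HB.instance Definition _ := Measure.on fmeasure_add.

Let fmeasure_add_fin : fin_num_fun fmeasure_add.
Proof.
by move=> A mA; rewrite /fmeasure_add measure_addE fin_numD !fin_num_measure.
Qed.

HB.instance Definition _ :=
  Measure_isFinite.Build _ _ _ fmeasure_add fmeasure_add_fin.

Lemma fmeasure_addE A : (fmeasure_add : fmeasure R S) A = (rho1 A + rho2 A)%E.
Proof. exact: measure_addE. Qed.

End FMeasureAdd.

Section Pairing.
Variables (R : realType) (S : ptopologicalType) (K : set S).
Hypotheses (hS : hausdorff_space S) (cK : compact K).
Implicit Types rho : fmeasure R S.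

Lemma pairingZ rho (a : R) (phi : S -> R) : {within K, continuous phi} ->
  pairing K (fun z => a * phi z) rho = a * pairing K phi rho.
Proof.
move=> cphi; apply: RintegralZl; first exact: borel_compact.
exact: compact_integrable.
Qed.

Lemma pairing_sum rho p (phi : 'I_p -> S -> R) :
  (forall i, {within K, continuous (phi i)}) ->
  pairing K (fun z => \sum_i phi i z) rho = \sum_i pairing K (phi i) rho.
Proof.
elim: p phi => [phi _|p IH phi cphi].
  rewrite big_ord0 /pairing; under eq_Rintegral do rewrite big_ord0.
  by rewrite Rintegral_cst ?mul0r//; exact: borel_compact.
rewrite big_ord_recl -IH// /pairing.
under eq_Rintegral do rewrite big_ord_recl.
rewrite RintegralD//; first exact: borel_compact.
  exact: compact_integrable.
by apply: compact_integrable => //; exact: within_continuous_sum.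
Qed.

Lemma pairing_linear rho p (c : 'I_p -> R) (phi : 'I_p -> S -> R) :
  (forall i, {within K, continuous (phi i)}) ->
  pairing K (fun z => \sum_i c i * phi i z) rho
  = \sum_i c i * pairing K (phi i) rho.
Proof.
move=> cphi; rewrite pairing_sum; last by move=> i; exact: within_continuousZ.
by apply: eq_bigr => i _; rewrite pairingZ.
Qed.

Lemma eq_pairing rho (phi psi : S -> R) : {in K, phi =1 psi} ->
  pairing K phi rho = pairing K psi rho.
Proof. by move=> e; apply: eq_Rintegral => z /e. Qed.

(** Only an upper bound on the mass is known, so passing from [s * rho K] to [s * B] relies on
    [0 <= s]. *)
Lemma pairing_le rho (phi : S -> R) (B s : R) :
  (rho setT <= B%:E)%E -> 0 <= s ->
  {within K, continuous phi} -> (forall z, K z -> phi z <= s) ->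
  pairing K phi rho <= s * B.
Proof.
move=> rB s0 cphi phis; have mK := borel_compact hS cK.
apply: (@le_trans _ _ (pairing K (fun=> s) rho)).
  apply: le_Rintegral => //; first exact: compact_integrable.
  by apply: compact_integrable => // z; exact: cvg_cst.
rewrite /pairing Rintegral_cst// ler_wpM2l//.
rewrite -lee_fin fineK ?fin_num_measure//; apply: le_trans rB.
by apply: le_measure => //; rewrite inE//; exact: measurableT.
Qed.

Lemma pairing_scaled_dirac (k : {nonneg R}) (z : S) (phi : S -> R) : K z ->
  {within K, continuous phi} ->
  pairing K phi (mscale k (dirac (z : borel S))) = k%:num * phi z.
Proof.
move=> Kz cphi; have mK := borel_compact hS cK.
have mphi : measurable_fun (K : set (borel S)) (fun x : borel S => (phi x)%:E).
  by apply/measurable_EFinP; exact: borel_within_continuous.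
(* Scaling acts on the positive and negative parts separately; the two values at [z] recombine to
   [phi z]. *)
rewrite /pairing /Rintegral integralE !ge0_integral_mscale//; last 2 first.
  exact: measurable_funeneg.
  exact: measurable_funepos.
rewrite !integral_dirac//; last 2 first.
  exact: measurable_funeneg.
  exact: measurable_funepos.
rewrite !diracE !mem_set// !mul1e funeposE funenegE -EFinN -!EFin_max.
rewrite -!EFinM -EFinN -EFinD/= -mulrBr; congr (_ * _).
have [p0|/ltW p0] := leP 0 (phi z).
  by rewrite (max_r _) ?oppr_le0// subr0.
by rewrite (max_l _) ?oppr_ge0// opprK add0r.
Qed.

Lemma pairing_add rho1 rho2 (phi : S -> R) : {within K, continuous phi} ->
  pairing K phi (fmeasure_add rho1 rho2)
  = pairing K phi rho1 + pairing K phi rho2.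
Proof.
move=> cphi; have mK := borel_compact hS cK.
have i1 := compact_integrable rho1 hS cK cphi.
have i2 := compact_integrable rho2 hS cK cphi.
rewrite /pairing /Rintegral integral_measure_add// fineD//.
  exact: integrable_fin_num.
exact: integrable_fin_num.
Qed.

(** Built by adding one weighted Dirac mass at a time; it turns a conic sum of values into a vector
    of integrals. *)
Lemma atomic_measure p (c : 'I_p -> R) (z : 'I_p -> S) :
  (forall i, 0 <= c i) -> (forall i, K (z i)) ->
  exists rho, [/\ carried_by K rho, rho setT = (\sum_i c i)%:E &
    forall phi : S -> R, {within K, continuous phi} ->
      pairing K phi rho = \sum_i c i * phi (z i)].
Proof.
elim: p c z => [c z _ _|p IH c z c0 Kz].
  exists mzero; split => //; first by rewrite big_ord0.
  by move=> phi _; rewrite big_ord0 /pairing /Rintegral integral_measure_zero.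
have [rho [rK rT rphi]] :=
  IH _ _ (fun i => c0 (lift ord0 i)) (fun i => Kz (lift ord0 i)).
pose del : fmeasure R S := mscale (NngNum (c0 ord0)) (dirac (z ord0 : borel S)).
exists (fmeasure_add del rho); split.
- rewrite /carried_by fmeasure_addE rK adde0 /del/= /mscale/= diracE.
  by rewrite memNset ?mule0// => /(_ (Kz _)).
- by rewrite fmeasure_addE rT /del/= /mscale/= diracE in_setT mule1 big_ord_recl.
- move=> phi cphi; rewrite pairing_add// big_ord_recl rphi//.
  by rewrite pairing_scaled_dirac.
Qed.

End Pairing.

(** * Conic combinations of bounded weight: Caratheodory reduction, convexity, compactness *)

Definition cone_sums (R : realType) (p N : nat) (B : R) (Y : set 'rV[R]_p) :
    set 'rV[R]_p :=
  [set y | exists c : 'I_N -> R, exists v : 'I_N -> 'rV[R]_p,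
     [/\ forall i, 0 <= c i, \sum_i c i <= B, forall i, Y (v i) &
         y = \sum_i c i *: v i]].

(* The sign of the relation makes sure that subtracting a multiple of it from the
   weights does not increase their sum. *)
Lemma row_dependency (R : realType) (p N : nat) (v : 'I_N -> 'rV[R]_p) :
  (p < N)%N -> exists a : 'I_N -> R,
    [/\ exists i, 0 < a i, 0 <= \sum_i a i & \sum_i a i *: v i = 0].
Proof.
move=> pN; pose A := \matrix_i v i.
(* With more rows than columns, the rank is below [N] and the left kernel is nontrivial. *)
have : kermx A != 0.
  rewrite kermx_eq0 /row_free; apply: contraTN pN => /eqP <-.
  by rewrite -leqNgt rank_leq_col.
case/rowV0Pn => u /sub_kermxP uA u0.
have uS : \sum_i u 0 i *: v i = 0.
  by rewrite -[RHS]uA mulmx_sum_row; apply: eq_bigr => i _; rewrite rowK.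
wlog S0 : u {uA} u0 uS / 0 <= \sum_i u 0 i.
  move=> W; have [|/ltW S0] := leP 0 (\sum_i u 0 i); first exact: W.
  apply: (W (- u)); rewrite ?oppr_eq0//.
    under eq_bigr do rewrite mxE scaleNr.
    by rewrite sumrN uS oppr0.
  by under eq_bigr do rewrite mxE; rewrite sumrN oppr_ge0.
exists (u 0); split => //.
(* With no positive entry, [- u] would have nonnegative entries of nonpositive sum, so [u] would
   vanish. *)
apply: contrapT => /forallNP a0; move/negP: u0; apply.
have {}a0 i : 0 <= - u 0 i by rewrite oppr_ge0 leNgt; apply/negP/a0.
have : \sum_i - u 0 i == 0.
  by rewrite eq_le sumr_ge0 ?andbT// sumrN oppr_le0.
rewrite psumr_eq0// => /allP z; apply/eqP/rowP => i; rewrite mxE.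
by apply/eqP; rewrite -oppr_eq0; apply: (implyP (z i _)); rewrite ?mem_index_enum.
Qed.

(** Subtracting from the weights the largest multiple [t] of a linear relation that keeps them
    nonnegative makes the [j]-th one vanish. Since the total weight is only bounded above, a linear
    relation suffices rather than an affine one, so [p] terms remain and not [p + 1]. *)
Lemma cone_sums_reduce (R : realType) (p N : nat) (B : R) (Y : set 'rV[R]_p) :
  (p <= N)%N -> cone_sums N.+1 B Y `<=` cone_sums N B Y.
Proof.
move=> pN y [c [v [c0 cB Yv ->]]].
have [a [[i0 ai0] aS av]] := row_dependency v pN.
pose j := [arg min_(i < i0 | 0 < a i) (c i / a i)]%O.
have [aj jmin] : 0 < a j /\ forall i, 0 < a i -> c j / a j <= c i / a i.
  by rewrite /j; case: arg_minP => // k ak kmin; split.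
pose t := c j / a j.
have t0 : 0 <= t by rewrite divr_ge0// ltW.
pose c' i := c i - t * a i.
have c'0 i : 0 <= c' i.
  rewrite subr_ge0; have [ai|ai] := ltP 0 (a i).
    by rewrite -ler_pdivlMr// jmin.
  by rewrite (le_trans _ (c0 i))// mulr_ge0_le0.
have c'j : c' j = 0 by rewrite /c' /t divfK ?subrr// gt_eqF.
exists (c' \o lift j), (v \o lift j); split => //=.
  apply: le_trans cB; apply: (@le_trans _ _ (\sum_i c' i)).
    by rewrite (bigD1_ord j)//= c'j add0r.
  by rewrite /c' sumrB -mulr_sumr gerBl mulr_ge0.
transitivity (\sum_i c' i *: v i); last first.
  by rewrite (bigD1_ord j)//= c'j scale0r add0r.
under [RHS]eq_bigr do rewrite scalerBl -scalerA.
by rewrite sumrB -scaler_sumr av scaler0 subr0.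
Qed.

Lemma cone_sums_caratheodory (R : realType) (p N : nat) (B : R)
  (Y : set 'rV[R]_p) : cone_sums (p + N) B Y `<=` cone_sums p B Y.
Proof.
elim: N => [|N IH]; first by rewrite addn0.
by rewrite addnS => y /(cone_sums_reduce (leq_addr _ _))/IH.
Qed.

Lemma cone_sums_cat (R : realType) (p N N' : nat) (B B' : R)
  (Y : set 'rV[R]_p) y y' : cone_sums N B Y y -> cone_sums N' B' Y y' ->
  cone_sums (N + N') (B + B') Y (y + y').
Proof.
move=> [c [v [c0 cB Yv ->]]] [c' [v' [c'0 c'B' Yv' ->]]].
exists (fun i => match fintype.split i with inl k => c k | inr k => c' k end).
exists (fun i => match fintype.split i with inl k => v k | inr k => v' k end).
split.
- by move=> i; case: fintype.split.
- rewrite big_split_ord/=; under eq_bigr do rewrite (unsplitK (inl _)).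
  by under [X in _ + X]eq_bigr do rewrite (unsplitK (inr _)); rewrite lerD.
- by move=> i; case: fintype.split.
- rewrite big_split_ord/=; under [in RHS]eq_bigr do rewrite (unsplitK (inl _)).
  by under [X in _ = _ + X]eq_bigr do rewrite (unsplitK (inr _)).
Qed.

Lemma cone_sums_scale (R : realType) (p N : nat) (B t : R)
  (Y : set 'rV[R]_p) y : 0 <= t -> cone_sums N B Y y ->
  cone_sums N (t * B) Y (t *: y).
Proof.
move=> t0 [c [v [c0 cB Yv ->]]]; exists (fun i => t * c i), v; split => //.
- by move=> i; rewrite mulr_ge0.
- by rewrite -mulr_sumr ler_wpM2l.
- by rewrite scaler_sumr; apply: eq_bigr => i _; rewrite scalerA.
Qed.

(* Two sums of p terms combine into one of 2p terms, which Caratheodory's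
   reduction brings back to p terms. *)
Lemma cone_sums_convex (R : realType) (p : nat) (B t : R) (Y : set 'rV[R]_p)
    y y' : 0 <= t <= 1 -> cone_sums p B Y y -> cone_sums p B Y y' ->
  cone_sums p B Y ((1 - t) *: y + t *: y').
Proof.
move=> /andP[t0 t1] Dy Dy'; apply: (@cone_sums_caratheodory _ _ p).
rewrite -[B]mul1r -{1}(subrK t 1) mulrDl.
by apply: cone_sums_cat; apply: cone_sums_scale; rewrite ?subr_ge0.
Qed.

(** These are the points at which the separating functional is tested in [moments_cone_sums]. *)
Lemma cone_sums_point (R : realType) (p : nat) (B : R) (Y : set 'rV[R]_p)
    v : (0 < p)%N -> 0 <= B -> Y v ->
  cone_sums p B Y (B *: v) /\ cone_sums p B Y 0.
Proof.
case: p Y v => // p Y v _ B0 Yv; split.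
  exists (fun i => if i == ord0 then B else 0), (fun=> v); split => //.
  - by move=> i; case: ifP.
  - by rewrite big_ord_recl/= big1 ?addr0.
  - by rewrite big_ord_recl/= big1 ?addr0// => i _; rewrite scale0r.
exists (fun=> 0), (fun=> v); split => //; first by rewrite big1.
by rewrite big1// => i _; rewrite scale0r.
Qed.

Lemma rV_coord_continuous (T : topologicalType) (n : nat) (i : 'I_n) :
  continuous (fun v : 'rV[T]_n => v ord0 i).
Proof.
move=> v P nP; exists (fun _ k => if k == i then P else setT).
  by move=> j k; rewrite [j]ord1; case: eqP => [->|_]//; exact: filterT.
by move=> w /(_ ord0 i); rewrite eqxx.
Qed.

(** A continuous image of weights times points. Each weight is at most the total, so the weights may
    be confined to the compact box of side [[0, B]]. *)
Lemma compact_cone_sums (R : realType) (p N : nat) (B : R) (Y : set 'rV[R]_p) :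
  compact Y -> compact (cone_sums N B Y).
Proof.
move=> cY.
pose C := [set c : 'rV[R]_N | forall i, `[0, B]%classic (c 0 i)]
  `&` [set c | \sum_i c 0 i <= B].
have cC : compact C.
  apply: compact_closedI; first exact:
    (@rV_compact R N (fun=> `[0, B]%classic) (fun=> @segment_compact _ _ _)).
  apply: (@preimage_closed _ _ (fun c : 'rV[R]_N => \sum_i c 0 i)
    [set x | x <= B]).
    have csum : continuous (fun c : 'rV[R]_N => \sum_i c 0 i).
      apply: continuous_big => [|i _]; first exact: add_continuous.
      exact: rV_coord_continuous.
    by move=> x _; exact: csum.
  exact: closed_le.
have cV : compact [set v : 'rV['rV[R]_p]_N | forall i, Y (v 0 i)].
  exact: (@rV_compact _ N (fun=> Y)).
suff -> : cone_sums N B Y = (fun cv : 'rV[R]_N * 'rV['rV[R]_p]_N =>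
   \sum_i cv.1 0 i *: cv.2 0 i) @` (C `*` [set v : 'rV['rV[R]_p]_N | forall i, Y (v 0 i)]).
  apply: continuous_compact; last exact: compact_setX.
  apply: continuous_subspaceT => x.
  apply: cvg_big => [|i _]; [exact: add_continuous|apply: cvgZ].
    apply: (@cvg_comp _ _ _ fst (fun v : 'rV[R]_N => v 0 i)).
      exact: cvg_fst.
    exact: rV_coord_continuous.
  apply: (@cvg_comp _ _ _ snd (fun v : 'rV['rV[R]_p]_N => v 0 i)).
    exact: cvg_snd.
  exact: rV_coord_continuous.
apply/seteqP; split => y.
  move=> [c [v [c0 cB Yv ->]]].
  exists (\row_i c i, \row_i v i) => /=; last first.
    by apply: eq_bigr => i _; rewrite !mxE.
  split; last by move=> i /=; rewrite mxE.
  have cB' : \sum_i (\row_i c i) 0 i <= B by under eq_bigr do rewrite mxE.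
  split => //= i; rewrite in_itv/= mxE c0/= (le_trans _ cB)//.
  by rewrite (bigD1 i)//= lerDl sumr_ge0.
move=> [[c v] /= [[/= cb cB] Yv] <-]; exists (c 0), (v 0); split => //.
by move=> i; have := cb i; rewrite in_itv/= => /andP[].
Qed.

(** * Coordinatewise convergence and projection onto a compact convex set *)

Lemma cvg_rV (T : Type) (F : set_system T) (U : topologicalType) (p : nat)
    (f : T -> 'rV[U]_p) (v : 'rV[U]_p) : Filter F ->
  (forall i, f x ord0 i @[x --> F] --> v ord0 i) -> f x @[x --> F] --> v.
Proof.
move=> FF fv A [P vP PA].
have : \forall x \near F, forall i, P ord0 i (f x ord0 i).
  by apply: filter_forall => i; apply: fv; exact: vP.
apply: filterS => x Px; apply: PA => j i; rewrite [j]ord1; exact: Px.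
Qed.

(** Here [w] minimises the squared Euclidean distance [f] to [x]; a violated inequality would allow
    a decrease of [f] along the segment from [w] to [y]. *)
Lemma nearest_point_normal (R : realType) (p : nat) (D : set 'rV[R]_p)
    (x : 'rV[R]_p) : D !=set0 -> compact D ->
  (forall t y y', 0 <= t <= 1 -> D y -> D y' -> D ((1 - t) *: y + t *: y')) ->
  exists2 w, D w & forall y, D y ->
    \sum_i (x - w) 0 i * (y - w) 0 i <= 0.
Proof.
move=> D0 cD convD.
pose f (y : 'rV[R]_p) := \sum_i (x 0 i - y 0 i) ^+ 2.
have cf : continuous f.
  apply: continuous_big => [|i _]; first exact: add_continuous.
  have cd : continuous (fun z : 'rV[R]_p => x 0 i - z 0 i).
    move=> z; apply: continuousB; first exact: cst_continuous.
    exact: coord_continuous.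
  by move=> z; exact: (continuousM (cd z) (cd z)).
have [w /set_mem Dw wmin] := EVT_min_rV D0 cD (continuous_subspaceT cf).
exists w => // y Dy; set s := \sum_i _.
rewrite leNgt; apply/negP => s0.
pose q := \sum_i ((y - w) 0 i) ^+ 2.
have q0 : 0 <= q by apply: sumr_ge0 => i _; exact: sqr_ge0.
have sq : 0 < s + q by rewrite ltr_wpDr.
(* A step [t] lowers [f] by [t * (2 * s - t * q)]; this choice ensures [t <= 1] and [t * q <= s],
   even when [q] is zero. *)
pose t := s / (s + q).
have t0 : 0 < t by rewrite divr_gt0.
have t1 : t <= 1 by rewrite ler_pdivrMr// mul1r lerDl.
have := wmin _ (mem_set (convD t w y _ Dw Dy)); rewrite t1 ltW// => /(_ isT).
have -> : f ((1 - t) *: w + t *: y) = f w - t * (2 * s - t * q).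
  rewrite /f /s /q !mulr_sumr -!sumrB mulr_sumr -sumrB.
  apply: eq_bigr => i _; rewrite !mxE; ring.
rewrite -[leLHS]subr0 lerD2l lerN2 pmulr_rle0//; apply/negP.
rewrite -ltNge subr_gt0.
have tq : t * q <= s.
  by rewrite /t mulrAC ler_pdivrMr// ler_pM2l// lerDr ltW.
by apply: le_lt_trans tq _; rewrite ltr_pMl ?ltr1n.
Qed.

(** * Moment vectors of measures of bounded mass *)

Definition moments (R : realType) (S : ptopologicalType) (K : set S) (p : nat)
    (phi : 'I_p -> S -> R) (rho : fmeasure R S) : 'rV[R]_p :=
  \row_i pairing K (phi i) rho.

Section Moments.
Variables (R : realType) (S : ptopologicalType) (K : set S).
Hypotheses (hS : hausdorff_space S) (cK : compact K).
Variables (p : nat) (phi : 'I_p.+1 -> S -> R) (B : R).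
Hypotheses (cphi : forall i, {within K, continuous (phi i)}) (B0 : 0 < B).

Let values := [set \row_i phi i z | z in K].

Let compact_values : compact values.
Proof.
apply: continuous_compact => // z; apply: cvg_rV => i.
under eq_cvg do rewrite mxE.
by rewrite mxE; exact: cphi.
Qed.

Lemma moments_cone_sums (rho : fmeasure R S) :
  K !=set0 -> (rho setT <= B%:E)%E ->
  cone_sums p.+1 B values (moments K phi rho).
Proof.
move=> [z0 Kz0] rB; set m := moments K phi rho; set D := cone_sums _ _ _.
have DB z : K z -> D (B *: (\row_i phi i z)).
  by move=> Kz; apply: (cone_sums_point _ (ltW B0) _).1 => //; exists z.
have D0 : D 0.
  apply: (cone_sums_point (v := \row_i phi i z0) _ (ltW B0) _).2 => //.
  by exists z0.
have [|||w Dw wP] := @nearest_point_normal _ _ D m; first by exists 0.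
- exact: compact_cone_sums.
- by move=> t y y' t01 Dy Dy'; exact: cone_sums_convex.
(* The hyperplane of normal [lam] and level [W] supports [D] at [w]. *)
pose lam : 'rV[R]_p.+1 := m - w; pose W := \sum_i lam 0 i * w 0 i.
have lamD y : D y -> \sum_i lam 0 i * y 0 i <= W.
  move=> /wP yw; rewrite -subr_le0 -sumrB; apply: le_trans yw.
  by apply: ler_sum => i _; rewrite -mulrBr !mxE.
have W0 : 0 <= W.
  by apply: le_trans (lamD _ D0); rewrite big1// => i _; rewrite [X in _ * X]mxE mulr0.
have mW : \sum_i lam 0 i * m 0 i <= W.
  rewrite -[leRHS](divfK (lt0r_neq0 B0)).
  have -> : \sum_i lam 0 i * m 0 i
      = pairing K (fun z => \sum_i lam 0 i * phi i z) rho.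
    by rewrite pairing_linear//; apply: eq_bigr => i _; rewrite [m _ _]mxE.
  apply: pairing_le => //; first by rewrite divr_ge0// ltW.
    by apply: within_continuous_sum => i; exact: within_continuousZ.
  (* Testing the supporting inequality at [B] times the values at [z] bounds the integrand by
     [W / B] on [K]. *)
  move=> z Kz; rewrite ler_pdivlMr// mulr_suml; apply: le_trans (lamD _ (DB _ Kz)).
  by apply: ler_sum => i _; rewrite !mxE mulrA mulrAC -mulrA.
have lamE j : lam 0 j = m 0 j - w 0 j by rewrite !mxE.
suff -> : m = w by [].
apply/eqP; rewrite -subr_eq0 -/lam; apply/eqP/rowP => i; rewrite [RHS]mxE.
(* The squared length of [lam] is the pairing of [lam] with [m] minus [W], which [mW] makes
   nonpositive. *)
have /eqP : \sum_i lam 0 i ^+ 2 = 0.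
  apply/eqP; rewrite eq_le sumr_ge0 ?andbT; last by move=> *; exact: sqr_ge0.
  apply: (@le_trans _ _ (\sum_i lam 0 i * m 0 i - W)); last by rewrite subr_le0.
  rewrite -sumrB; apply: ler_sum => j _.
  by rewrite -mulrBr -lamE expr2.
rewrite psumr_eq0; last by move=> *; exact: sqr_ge0.
by move=> /allP/(_ i (mem_index_enum _)); rewrite sqrf_eq0 => /eqP.
Qed.

Lemma compact_moments : compact [set moments K phi rho |
  rho in [set rho : fmeasure R S | carried_by K rho /\ (rho setT <= B%:E)%E]].
Proof.
set M := (X in compact X).
(* For empty [K] there is no value to combine, so [cone_sums] is empty, while the zero measure still
   has the moment vector 0. *)
have [K0|/set0P K0] := eqVneq K set0.
  have m0 (rho : fmeasure R S) : moments K phi rho = 0.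
    by apply/rowP => i; rewrite !mxE K0 /pairing Rintegral_set0.
  suff -> : M = [set 0] by exact: compact_set1.
  apply/seteqP; split => [_ [rho _ <-]|_ ->]; first exact: m0.
  by exists mzero => //; split => //; exact: ltW.
suff -> : M = cone_sums p.+1 B values.
  exact: compact_cone_sums.
apply/seteqP; split => [_ [rho [_ rB] <-]|y [c [v [c0 cB vv ->]]]].
  exact: moments_cone_sums.
(* The points [v i] are lifted to points of [K], which carry the atoms. *)
have /choice[z zP] i : exists z, K z /\ \row_j phi j z = v i.
  by have [z] := vv i; exists z.
have [rho [rK rT rphi]] := @atomic_measure _ _ _ hS cK _ c z c0 (fun i => (zP i).1).
exists rho; first by split => //; rewrite rT lee_fin.
apply/rowP => j; rewrite mxE rphi// summxE; apply: eq_bigr => i _.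
by rewrite -(zP i).2 !mxE.
Qed.

End Moments.

(** * Continuity of costs and norms, and inequalities at cluster points *)

Lemma within_continuous_snd (R : realType) (S S' : topologicalType)
    (A : set S) (X : set S') (g : S' -> R) : {within X, continuous g} ->
  {within A `*` X, continuous (fun p => g p.2)}.
Proof.
move=> /subspace_continuousP cg; apply/subspace_continuousP => p [_ Xp].
apply: cvg_trans (cg _ Xp) => B; rewrite /= /within/= => nB.
have : nbhs p (snd @^-1` [set y | X y -> B (g y)]).
  by apply: (@cvg_snd _ _ (nbhs p.1) (nbhs p.2)).
by apply: filterS => q Bq [_ /Bq].
Qed.

(** Nonnegativity comes from the triangle inequality for [x] and [- x]. Expanding [x - y] in the
    canonical basis dominates [N x - N y] by [G y], which is continuous and vanishes at [x]. *)
Lemma norm_continuous_rV (R : realType) (m : nat) (N : 'rV[R]_m -> R) :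
  is_norm N -> (forall x, 0 <= N x) /\ continuous N.
Proof.
move=> [ND NZ _].
have N0 : N 0 = 0 by rewrite -(scale0r 0) NZ normr0 mul0r.
have Nopp x : N (- x) = N x by rewrite -scaleN1r NZ normrN1 mul1r.
have Nge0 x : 0 <= N x.
  by have := ND x (- x); rewrite subrr N0 Nopp -mulr2n pmulrn_lge0.
split => // x.
have Nsum (J : Type) (r : seq J) (F : J -> 'rV[R]_m) :
    N (\sum_(j <- r) F j) <= \sum_(j <- r) N (F j).
  elim/big_rec2 : _ => [|j s y _ ys]; first by rewrite N0.
  by apply: le_trans (ND _ _) _; rewrite lerD2l.
pose G (y : 'rV[R]_m) := \sum_j `|x 0 j - y 0 j| * N (delta_mx 0 j).
have NG y : `|N x - N y| <= G y.
  have Nxy : N (x - y) <= G y.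
    rewrite [x - y]row_sum_delta; apply: le_trans (Nsum _ _ _) _.
    by apply: ler_sum => j _; rewrite NZ !mxE.
  have Nyx : N (y - x) <= G y by rewrite -opprB Nopp.
  have := ND (x - y) y; have := ND (y - x) x; rewrite !subrK ler_norml => Ny Nx.
  by apply/andP; split; lra.
have cG : continuous G.
  apply: continuous_big => [|j _ y]; first exact: add_continuous.
  have cx : continuous (fun z : 'rV[R]_m => x 0 j - z 0 j).
    move=> z; apply: continuousB; first exact: cst_continuous.
    exact: coord_continuous.
  have cn : continuous (fun z : 'rV[R]_m => `|x 0 j - z 0 j|).
    move=> z; apply: (continuous_comp (cx z)); exact: norm_continuous.
  exact: (continuousM (cn y) (@cst_continuous _ _ (N (delta_mx 0 j)) y)).
have Gx : G x = 0 by rewrite /G big1// => j _; rewrite subrr normr0 mul0r.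
apply/(@cvgrPdist_lt _ _ _ (nbhs x) (nbhs_filter x)) => e e0.
have : \forall y \near x, G y < e.
  by apply: (@cvgr_lt _ _ _ (nbhs_filter x) _ _ (cG x)); rewrite Gx.
by apply: filterS => y; exact: le_lt_trans.
Qed.

(** Carries bounds on cost and residual to an accumulation point without extracting a
    subsequence. *)
Lemma cluster_le (R : realType) (S : topologicalType) (F : set_system S)
    (p : S) (h : S -> R) (s : R) : continuous h -> cluster F p ->
  F [set x | h x <= s] -> h p <= s.
Proof.
move=> ch Fp Fs; rewrite leNgt; apply/negP => sp.
have np : nbhs p [set x | s < h x] by exact: (cvgr_gt _ (ch p)).
have [x [/= xs sx]] := Fp _ _ Fs np.
by rewrite ltNge xs in sx.
Qed.

(** * Linearity in the test function and feasibility of limits *)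

Section Problem.
Variables (R : realType) (n d : nat) (pb : ocp R n d).

Lemma C1_within_continuous v A : C1 pb v -> A `<=` tx_set pb ->
  {within A, continuous v}.
Proof.
case=> [U [_ AU vU]] AK; apply: continuous_in_subspaceT => p /set_mem Ap.
by have [dv _ _] := vU _ (AU _ (AK _ Ap)); exact: differentiable_continuous.
Qed.

Lemma derive_combination m (c : 'I_m -> R) (v : 'I_m -> R * 'rV[R]_n -> R) p h :
  (forall j, differentiable (v j) p) ->
  'D_h (fun q => \sum_j c j * v j q) p = \sum_j c j * 'D_h (v j) p.
Proof.
move=> dv.
have -> : (fun q => \sum_j c j * v j q) = \sum_j c j \*: v j.
  by apply/funext => q; rewrite fct_sumE.
rewrite derive_sum; last by move=> j; apply: derivableZ; exact: diff_derivable.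
by apply: eq_bigr => j _; rewrite deriveZ//; exact: diff_derivable.
Qed.

Lemma Lf_combination m (c : 'I_m -> R) (v : 'I_m -> R * 'rV[R]_n -> R) z :
  (forall j, C1 pb (v j)) -> tx_set pb z.1 ->
  Lf pb (fun q => \sum_j c j * v j q) z = \sum_j c j * Lf pb (v j) z.
Proof.
move=> vC1 Kz.
have dv j : differentiable (v j) z.1.
  by have [U [_ AU vU]] := vC1 j; have [] := vU _ (AU _ Kz).
rewrite /Lf /dt derive_combination//.
under [RHS]eq_bigr do rewrite mulrDr.
rewrite big_split/=; congr (_ + _).
under [RHS]eq_bigr do rewrite mulr_sumr.
rewrite exchange_big/=; apply: eq_bigr => i _.
rewrite mxE derive_combination// mulr_suml.
by apply: eq_bigr => j _; rewrite mxE mulrA.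
Qed.

Hypotheses (ht : t_ini pb < t_fin pb)
  (hX : compact (state_set pb)) (hU : compact (control_set pb))
  (hl : {within txu_set pb, continuous (running_cost pb)})
  (hg : {within state_set pb, continuous (terminal_cost pb)})
  (hL : forall v, C1 pb v -> {within txu_set pb, continuous (Lf pb v)}).
Variables (mu0 : fmeasure R (R * 'rV[R]_n)%type)
  (vs : nat -> R * 'rV[R]_n -> R).
Hypothesis hvs : forall j, C1 pb (vs j).

Let hausTX : hausdorff_space (R * 'rV[R]_n)%type.
Proof. exact: (@norm_hausdorff R (R * 'rV[R]_n)%type). Qed.

Let hausTXU : hausdorff_space (R * 'rV[R]_n * 'rV[R]_d)%type.
Proof. exact: (@norm_hausdorff R (R * 'rV[R]_n * 'rV[R]_d)%type). Qed.

Let compact_txu : compact (txu_set pb).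
Proof.
by apply: compact_setX hU; apply: compact_setX hX; exact: segment_compact.
Qed.

Let compact_init : compact (init_set pb).
Proof. by apply: compact_setX hX; exact: compact_set1. Qed.

Let compact_term : compact (term_set pb).
Proof. by apply: compact_setX hX; exact: compact_set1. Qed.

Let init_sub : init_set pb `<=` tx_set pb.
Proof. by case=> t x [/= -> Xx]; split => //=; rewrite in_itv/= lexx ltW. Qed.

Let term_sub : term_set pb `<=` tx_set pb.
Proof. by case=> t x [/= -> Xx]; split => //=; rewrite in_itv/= lexx ltW. Qed.

Lemma feasible_test_span m (q : mpair R n d) : admissible pb q ->
  residual pb mu0 vs m q = 0 -> feasible pb mu0 (test_span vs m) q.
Proof.
move=> qadm /rowP r0; split => // v [c ->].
have cvs A : A `<=` tx_set pb -> forall j : 'I_m, {within A, continuous (vs j)}.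
  by move=> AK j; exact: C1_within_continuous.
rewrite !pairing_linear//; [|exact: cvs|exact: cvs].
(* Linearity of [Lf] is known only where the generators are differentiable, so the integrands are
   compared on the domain alone. *)
rewrite (@eq_pairing _ _ _ q.1 _ (fun z => \sum_j c 0 j * Lf pb (vs j) z)).
  rewrite pairing_linear//; last by move=> j; exact: hL.
  rewrite -sumrB; apply: eq_bigr => j _; rewrite -mulrBr; congr (_ * _).
  by apply/eqP; rewrite -subr_eq0; have := r0 j; rewrite !mxE => /eqP.
by move=> z /set_mem[Kz _]; rewrite Lf_combination.
Qed.

Lemma cost_cvg (q_ : nat -> mpair R n d) (q : mpair R n d) :
  weak_star_cvg (txu_set pb) (fun k => (q_ k).1) q.1 ->
  weak_star_cvg (term_set pb) (fun k => (q_ k).2) q.2 ->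
  cost pb (q_ k) @[k --> \oo] --> cost pb q.
Proof.
move=> cv1 cv2; apply: cvgD; first exact: cv1.
by apply: cv2; exact: within_continuous_snd.
Qed.

(* The limit pair need not be a weak-star limit of trial pairs: it only has
   limiting moments, and may be taken finitely atomic. *)
Lemma limit_feasible m (N : 'rV[R]_m -> R) (B a : R) : is_norm N ->
  (forall eta : R, 0 < eta -> exists q : mpair R n d,
     [/\ admissible pb q, (q.1 setT <= B%:E)%E /\ (q.2 setT <= B%:E)%E,
         N (residual pb mu0 vs m q) <= eta & cost pb q <= a]) ->
  exists2 q, feasible pb mu0 (test_span vs m) q & cost pb q <= a.
Proof.
(* The compactness of moments asks for a positive mass bound; any larger bound serves as well. *)
move=> normN; wlog B0 : B / 0 < B.
  move=> W H; apply: (W (Num.max B 1)); first by rewrite lt_max ltr01 orbT.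
  move=> eta /H[q [adm [m1 m2] Nr ca]]; exists q; split => //.
  by split; [apply: le_trans m1 _|apply: le_trans m2 _]; rewrite lee_fin le_max lexx.
move=> H.
have [Nge0 cN] := norm_continuous_rV normN.
(* Coordinate 0 records the cost and coordinate [j + 1] the contribution of [vs j] to the residual,
   so both are continuous functions of the moments. *)
pose phi1 (i : 'I_m.+1) := if unlift ord0 i is Some j then Lf pb (vs j)
  else running_cost pb.
pose phi2 (i : 'I_m.+1) := if unlift ord0 i is Some j then vs j
  else (fun p => terminal_cost pb p.2).
have cphi1 i : {within txu_set pb, continuous (phi1 i)}.
  by rewrite /phi1; case: unlift => [j|//]; exact: hL.
have cphi2 i : {within term_set pb, continuous (phi2 i)}.
  rewrite /phi2; case: unlift => [j|]; first exact: C1_within_continuous.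
  exact: within_continuous_snd.
have cD := compact_setX (compact_moments hausTXU compact_txu cphi1 B0)
  (compact_moments hausTX compact_term cphi2 B0).
pose mom (q : mpair R n d) :=
  (moments (txu_set pb) phi1 q.1, moments (term_set pb) phi2 q.2).
pose costm (w : 'rV[R]_m.+1 * 'rV[R]_m.+1) := w.1 0 ord0 + w.2 0 ord0.
have costE q : cost pb q = costm (mom q).
  by rewrite /costm /= !mxE /phi1 /phi2 unlift_none.
pose resm (w : 'rV[R]_m.+1 * 'rV[R]_m.+1) := \row_(j < m)
  (w.2 0 (lift ord0 j) - pairing (init_set pb) (vs j) mu0 - w.1 0 (lift ord0 j)).
have resE q : residual pb mu0 vs m q = resm (mom q).
  by apply/rowP => j; rewrite !mxE /phi1 /phi2 liftK.
have c1 i : continuous (fun w : 'rV[R]_m.+1 * 'rV[R]_m.+1 => w.1 0 i).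
  move=> w; apply: (@cvg_comp _ _ _ fst (fun v : 'rV[R]_m.+1 => v 0 i)).
    exact: cvg_fst.
  exact: coord_continuous.
have c2 i : continuous (fun w : 'rV[R]_m.+1 * 'rV[R]_m.+1 => w.2 0 i).
  move=> w; apply: (@cvg_comp _ _ _ snd (fun v : 'rV[R]_m.+1 => v 0 i)).
    exact: cvg_snd.
  exact: coord_continuous.
have ccost : continuous costm by move=> w; apply: continuousD; [exact: c1|exact: c2].
have cres : continuous (N \o resm).
  move=> w; apply: continuous_comp; last exact: cN.
  apply: cvg_rV => j; rewrite mxE; under eq_cvg do rewrite mxE.
  apply: cvgB; last exact: c1.
  by apply: cvgB; [exact: c2|exact: cvg_cst].
have /choice[q_ qP] k : exists q : mpair R n d,
     [/\ admissible pb q, (q.1 setT <= B%:E)%E /\ (q.2 setT <= B%:E)%E,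
         N (residual pb mu0 vs m q) <= k.+1%:R^-1 & cost pb q <= a].
  by apply: H; rewrite invr_gt0.
(* The cluster point lies in the compact set of moments, hence is realised by measures [mu] and
   [muT]. *)
have [|w [[[mu [muK _] mu1] [muT [muTK _] mu2]] clw]] :=
    cD ((mom \o q_) @ \oo) _.
  exists 0%N => // k _; have [[K1 K2] [m1 m2] _ _] := qP k.
  by split; [exists (q_ k).1|exists (q_ k).2].
have wE : w = mom (mu, muT) by rewrite /mom/= mu1 mu2; case: (w).
exists (mu, muT).
  apply: feasible_test_span => //; rewrite resE -wE.
  have [_ _ Nsep] := normN; apply: Nsep; apply/eqP; rewrite eq_le Nge0 andbT.
  (* The residual at the cluster point has norm at most every [e > 0], by the bound [1 / (k + 1)]
     along the sequence. *)
  apply/ler_addgt0Pl => e e0; rewrite addr0.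
  apply: (cluster_le cres clw).
  have [k0 k0e] := ltr_add_invr e0; rewrite add0r in k0e.
  exists k0 => // k /= k0k; have [_ _ + _] := qP k; rewrite resE.
  move=> /le_trans; apply; apply: ltW; apply: le_lt_trans k0e.
  by rewrite lef_pV2 ?posrE// ler_nat.
rewrite costE -wE; apply: (cluster_le ccost clw).
by exists 0%N => // k _ /=; rewrite -costE; have [] := qP k.
Qed.

End Problem.

(** Reduces a comparison of possibly infinite values to real cost levels, the form that
    [limit_feasible] handles. *)
Lemma real_between_lee (R : realType) (x y : \bar R) :
  (forall a : R, (y < a%:E)%E -> (x <= a%:E)%E) -> (x <= y)%E.
Proof.
case: y => [r| |] H; last 1 first.
- case: x H => [r| |] H //.
    by have := H (r - 1)%R (ltNyr _); rewrite lee_fin lerBrDr gerDl ler10.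
  by have := H 0%R (ltNyr _).
- by apply/lee_addgt0Pr => e e0; rewrite -EFinD H// lte_fin ltrDl.
- exact: leey.
Qed.

(** * Limits in capacity, tolerance and number of tests *)

Theorem theorem1 (R : realType) (n d : nat) (pb : ocp R n d)
    (mu0 : fmeasure R (R * 'rV[R]_n)%type)
    (vs : nat -> R * 'rV[R]_n -> R)
    (N : forall m, 'rV[R]_m -> R)
    (Theta : nat -> set (param R))
    (occ : param R -> mpair R n d)
    (ht : t_ini pb < t_fin pb)
    (hX : compact (state_set pb))
    (hU : compact (control_set pb))
    (hl : {within txu_set pb, continuous (running_cost pb)})
    (hg : {within state_set pb, continuous (terminal_cost pb)})
    (hL : forall v, C1 pb v -> {within txu_set pb, continuous (Lf pb v)})
    (hmu0 : carried_by (init_set pb) mu0)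
    (hvs : forall j, C1 pb (vs j))
    (hN : forall m, (1 <= m)%N -> is_norm (N m))
    (hocc : forall M theta, (1 <= M)%N -> Theta M theta ->
       admissible pb (occ theta))
    (hmass : exists B : R, forall M theta, (1 <= M)%N -> Theta M theta ->
       ((occ theta).1 setT <= B%:E)%E /\ ((occ theta).2 setT <= B%:E)%E)
    (hnested : forall M, (1 <= M)%N -> Theta M `<=` Theta M.+1)
    (htrial : forall m, (1 <= m)%N -> trial_dense pb mu0 vs N Theta occ m) :
  (forall m, (1 <= m)%N ->
     (forall eta : R, 0 < eta ->
        cvg (P_exp pb mu0 vs N Theta occ m M eta @[M --> \oo])) /\
     lim (P_exp pb mu0 vs N Theta occ m M eta @[M --> \oo])
       @[eta --> 0^'+] --> P_trunc pb mu0 vs m) /\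
  (test_dense pb vs ->
   P_trunc pb mu0 vs m @[m --> \oo] --> P_exact pb mu0 ->
   lim (lim (P_exp pb mu0 vs N Theta occ m M eta @[M --> \oo])
          @[eta --> 0^'+]) @[m --> \oo] --> P_exact pb mu0).
Proof.
have P_exp_cvg m eta : P_exp pb mu0 vs N Theta occ m M eta @[M --> \oo] -->
    ereal_inf (range (fun M => P_exp pb mu0 vs N Theta occ m M.+1 eta)).
  (* Nesting starts at capacity 1, hence the shift; larger trial sets lower the infimum. *)
  rewrite -cvg_shiftS; apply: ereal_nonincreasing_cvgn.
  apply/nonincreasing_seqP => M; apply: le_ereal_inf => _ [th [thM Nth] <-].
  by exists th => //; split => //; exact: hnested.
have limE m eta : lim (P_exp pb mu0 vs N Theta occ m M eta @[M --> \oo]) =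
    ereal_inf (range (fun M => P_exp pb mu0 vs N Theta occ m M.+1 eta)).
  exact/cvg_lim/P_exp_cvg.
have main m : (1 <= m)%N ->
    lim (P_exp pb mu0 vs N Theta occ m M eta @[M --> \oo])
      @[eta --> 0^'+] --> P_trunc pb mu0 vs m.
  move=> m1; under eq_cvg do rewrite limE.
  set L := fun eta => ereal_inf _.
  (* [L] is nonincreasing in [eta], so its right limit at 0 is its supremum over positive [eta]. *)
  have -> : P_trunc pb mu0 vs m = ereal_sup (L @` `]0, +oo[).
    apply/eqP; rewrite eq_le; apply/andP; split.
      apply: real_between_lee => a supa.
      (* A level [a] above the supremum is beaten, for every tolerance, by a trial pair of some
         capacity; [limit_feasible] applies. *)
      have [B mass] := hmass.
      have [|q qF qa] := limit_feasible (a := a) (B := B) (mu0 := mu0)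
        ht hX hU hl hg hL hvs (hN m m1).
        move=> eta eta0.
        have : (L eta < a%:E)%E.
          apply: le_lt_trans supa; apply: ereal_sup_ubound.
          by exists eta => //=; rewrite in_itv/= eta0.
        move=> /ereal_inf_lt[_ [M _ <-]] /ereal_inf_lt[_ [th [thM Nth] <-]].
        rewrite lte_fin => /ltW tha; exists (occ th); split => //.
          exact: (hocc M.+1).
        exact: (mass M.+1).
      by apply: ge_ereal_inf; exists (cost pb q)%:E; [exists q|rewrite lee_fin].
    (* Conversely, trial pairs approximating a feasible [q] eventually meet the tolerance, so their
       costs bound [L eta] from above and tend to the cost of [q]. *)
    apply: ub_ereal_sup => _ [eta /= + <-]; rewrite in_itv/= andbT => eta0.
    apply/ereal_infP => _ [q qF <-].
    have [th [thM cv1 cv2 Nth]] := htrial m m1 q qF.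
    have cc : (cost pb (occ (th M)))%:E @[M --> \oo] --> (cost pb q)%:E.
      apply: cvg_EFin; first by near=> M.
      exact: cost_cvg.
    apply: (cvge_ge _ cc).
    have : \forall M \near \oo, N m (residual pb mu0 vs m (occ (th M))) < eta.
      exact: (cvgr_lt _ Nth).
    move=> Neta; near=> M.
    have M1 : (1 <= M)%N by near: M; exists 1%N.
    apply: (@le_trans _ _ (P_exp pb mu0 vs N Theta occ m M eta)).
      (* The infimum [L eta] is indexed by [M.+1], hence the predecessor. *)
      apply: ereal_inf_lbound; exists M.-1 => //; by rewrite prednK.
    apply: ereal_inf_lbound; exists (th M) => //; split; first exact: thM.
    by apply: ltW; near: M.
  apply: nonincreasing_at_right_cvge => // x y _ _ xy.
  apply/ereal_infP => _ [M _ <-]; apply: ge_ereal_inf.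
  exists (P_exp pb mu0 vs N Theta occ m M.+1 y); first by exists M.
  apply: le_ereal_inf => _ [th [thM Nth] <-]; exists th => //; split => //.
  exact: le_trans Nth xy.
split.
  move=> m m1; split; last exact: main.
  by move=> eta _; apply/cvg_ex; eexists; exact: P_exp_cvg.
move=> _; apply: cvg_trans; apply: near_eq_cvg.
(* From [m = 1] on, the iterated limit equals [P_trunc], whose limit is given. *)
exists 1%N => // m m1; symmetry; apply: cvg_lim => //; exact: main.
Unshelve. all: by end_near.
Qed.
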